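(* The right and the left structure racks of a solution $(X,r)$ are isomorphic. Concretely, the relation $$T(y\triangleright_r x)=T(x)\triangleleft_r T(y)$$ holds for all $x,y\in X$, where $T\colon X\to X$ is the bijection $y\mapsto\tau_y^{-1}(y)$.
   Context: A solution $(X,r)$ is a finite set $X$ with a bijection $r\colon X\times X\to X\times X$, $r(x,y)=(\sigma_x(y),\tau_y(x))$, satisfying the Yang--Baxter equation $r_1r_2r_1=r_2r_1r_2$ on $X^3$ ($r_1=r\times \mathrm{Id}_X$, $r_2=\mathrm{Id}_X\times r$), with all maps $\sigma_x,\tau_x\colon X\to X$ bijective. Its right structure rack is $(X,\triangleleft_r)$ with $x\triangleleft_r y=\tau_y\sigma_{\tau_x^{-1}(y)}(x)$, and its left structure rack is $(X,\triangleright_r)$ with $y\triangleright_r x=\sigma_y\tau_{\sigma_x^{-1}(y)}(x)$. A left rack $(X,\triangleright)$ is compared with a right rack by viewing it as the right rack with operation $(x,y)\mapsto y\triangleright x$. *)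

(* Defs.v *)
From mathcomp Require Import all_boot.

Set Implicit Arguments.
Unset Strict Implicit.
Unset Printing Implicit Defensive.

Record right_rack (X : Type) := RightRack {
  rrack_op :> X -> X -> X;
  rrack_trans_bij : forall y, bijective (fun x => rrack_op x y);
  rrack_distr : forall x y z,
    rrack_op (rrack_op x y) z = rrack_op (rrack_op x z) (rrack_op y z)
}.

Record left_rack (X : Type) := LeftRack {
  lrack_op :> X -> X -> X;
  lrack_trans_bij : forall y, bijective (fun x => lrack_op y x);
  lrack_distr : forall x y z,
    lrack_op z (lrack_op y x) = lrack_op (lrack_op z y) (lrack_op z x)
}.

Definition right_of_left (X : Type) (L : left_rack X) : right_rack X :=
  @RightRack X (fun x y => L y x) (lrack_trans_bij L) (lrack_distr L).

Definition rack_isomorphic (X Y : Type) (A : right_rack X) (B : right_rack Y) :=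
  exists2 f : X -> Y, bijective f & {morph f : x y / A x y >-> B x y}.

Section Maps.
Variables (X : Type) (r : X * X -> X * X).

(* r (x, y) = (sigma r x y, tau r y x) *)
Definition sigma (x y : X) : X := (r (x, y)).1.
Definition tau (y x : X) : X := (r (x, y)).2.

Definition ybe_r1 (p : X * X * X) : X * X * X :=
  let: (x, y, z) := p in (r (x, y), z).

Definition ybe_r2 (p : X * X * X) : X * X * X :=
  let: (x, y, z) := p in (x, (r (y, z)).1, (r (y, z)).2).

End Maps.

Record solution (X : finType) := Solution {
  sol_map :> X * X -> X * X;
  sol_bij : bijective sol_map;
  sol_ybe : ybe_r1 sol_map \o ybe_r2 sol_map \o ybe_r1 sol_map
            =1 ybe_r2 sol_map \o ybe_r1 sol_map \o ybe_r2 sol_map;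
  sol_sigma_bij : forall x, bijective (sigma sol_map x);
  sol_tau_bij : forall y, bijective (tau sol_map y)
}.

(* [finv f] is the inverse of [f] as soon as [f] is injective. *)

Definition left_op (X : finType) (r : X * X -> X * X) (y x : X) : X :=
  sigma r y (tau r (finv (sigma r x) y) x).

Definition right_op (X : finType) (r : X * X -> X * X) (x y : X) : X :=
  tau r y (sigma r (finv (tau r x) y) x).

Definition Tmap (X : finType) (r : X * X -> X * X) (y : X) : X :=
  finv (tau r y) y.

Section LeftRack.
Variables (X : finType) (r : solution X).
Local Notation s := (sigma r).
Local Notation t := (tau r).

Let s_inj x : injective (s x). Proof. exact: bij_inj (sol_sigma_bij r x). Qed.

Let ybeE x y z :
  [/\ s x (s y z) = s (s x y) (s (t y x) z),
      t (s (t y x) z) (s x y) = s (t (s y z) x) (t z y)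
    & t z (t y x) = t (t z y) (t (s y z) x)].
Proof.
have := sol_ybe r (x, y, z); rewrite /= /sigma /tau.
case: (r (x, y)) => a b /=; case: (r (y, z)) => c d /=.
case: (r (b, z)) => e f /=; case: (r (x, c)) => g h /=.
by case: (r (a, e)) => ? ?; case: (r (h, d)) => ? ? [-> -> ->].
Qed.

Lemma sol_sigmaE x y z : s x (s y z) = s (s x y) (s (t y x) z).
Proof. by case: (ybeE x y z). Qed.

Lemma sol_sigma_tauE x y z :
  t (s (t y x) z) (s x y) = s (t (s y z) x) (t z y).
Proof. by case: (ybeE x y z). Qed.

Lemma sol_tauE x y z : t z (t y x) = t (t z y) (t (s y z) x).
Proof. by case: (ybeE x y z). Qed.

Lemma left_op_sigma x u : left_op r (s x u) x = s (s x u) (t u x).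
Proof. by rewrite /left_op finv_f. Qed.

Lemma left_op_bij y : bijective (fun x => left_op r y x).
Proof.
apply: injF_bij => x x' /= /s_inj eq_t.
have e z : r (z, finv (s z) y) = (y, t (finv (s z) y) z).
  by rewrite [LHS]surjective_pairing -/(sigma r _ _) f_finv.
have := e x; rewrite eq_t -e => /(bij_inj (sol_bij r)).
by case.
Qed.

Lemma sigma_left_op z y x :
  s z (left_op r y x) = left_op r (s z y) (s z x).
Proof.
pose u := finv (s x) y; have Dy : y = s x u by rewrite f_finv.
rewrite Dy [in RHS](sol_sigmaE z x u) !left_op_sigma -sol_sigmaE.
by rewrite sol_sigma_tauE -sol_sigmaE.
Qed.

Lemma left_op_distr x y z :
  left_op r z (left_op r y x) = left_op r (left_op r z y) (left_op r z x).
Proof.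
pose u := finv (s x) y; have Dy : y = s x u by rewrite f_finv.
pose w := finv (s u) (finv (s x) z).
have Dz : z = s x (s u w) by rewrite !f_finv.
set e := t u x; pose c := t (s u w) x; pose b := t w u.
have yx : left_op r y x = s y e by rewrite Dy left_op_sigma.
have zx : left_op r z x = s z c by rewrite Dz left_op_sigma.
have Dzy : z = s y (s e w) by rewrite Dz Dy -sol_sigmaE.
have ty : t (s e w) y = s c b by rewrite Dy sol_sigma_tauE.
have zy : left_op r z y = s z (s c b) by rewrite {1}Dzy left_op_sigma -Dzy ty.
rewrite zy zx yx -sigma_left_op left_op_sigma.
rewrite {1}Dzy sol_sigmaE left_op_sigma -sol_sigmaE -Dzy.
by rewrite sol_sigma_tauE ty /e sol_tauE.
Qed.

Definition left_structure_rack : left_rack X :=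
  LeftRack left_op_bij left_op_distr.

End LeftRack.

(* Conjugating r by the flip exchanges sigma with tau, hence the left structure
   rack with the right one. *)

Section RightRack.
Variables (X : finType) (r : solution X).

Definition mirror_map (p : X * X) : X * X := let q := r (p.2, p.1) in (q.2, q.1).

Lemma mirror_bij : bijective mirror_map.
Proof.
apply: injF_bij => -[a b] [c d] [e2 e1].
have : r (b, a) = r (d, c).
  by rewrite (surjective_pairing (r (b, a))) e1 e2 -surjective_pairing.
by move/(bij_inj (sol_bij r)) => [-> ->].
Qed.

Lemma mirror_ybe : ybe_r1 mirror_map \o ybe_r2 mirror_map \o ybe_r1 mirror_map
  =1 ybe_r2 mirror_map \o ybe_r1 mirror_map \o ybe_r2 mirror_map.
Proof.
move=> [[x y] z]; have := sol_ybe r (z, y, x); rewrite /= /mirror_map /=.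
case: (r (z, y)) => a b /=; case: (r (y, x)) => c d /=.
case: (r (b, x)) => e f /=; case: (r (z, c)) => g h /=.
by case: (r (a, e)) => ? ?; case: (r (h, d)) => ? ? [-> -> ->].
Qed.

Definition mirror : solution X :=
  Solution mirror_bij mirror_ybe (sol_tau_bij r) (sol_sigma_bij r).

Lemma right_op_bij y : bijective (fun x => right_op r x y).
Proof. exact: (left_op_bij mirror y). Qed.

Lemma right_op_distr x y z :
  right_op r (right_op r x y) z = right_op r (right_op r x z) (right_op r y z).
Proof. exact: (left_op_distr mirror x y z). Qed.

Definition right_structure_rack : right_rack X :=
  RightRack right_op_bij right_op_distr.

End RightRack.

(* Main.v *)
Require Import Defs.
From mathcomp Require Import all_boot.

(** Write s_x and t_x for sigma and tau, <| for the right rack operation and |>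
    for the left one, and T y for the point characterised by t_y (T y) = y.

    Every t_z is an endomorphism of the right rack [tau_right_op].  This gives
    at once the injectivity of T, hence its bijectivity, X being finite: as
    y <| y = t_y (s_(T y) y) and y = t_y (T y), cancelling t_y leaves
    s_(T y) y = T y <| T y, which determines y from T y [sigma_Tmap].

    The relation comes from the way T intertwines the maps s and t, namely
    T (t_u x) = t_(s_x u) (T x) [Tmap_tau] and t_x (T (s_x y)) = T y <| x
    [tau_Tmap_sigma]; both rewrite the braid identity
    t_u t_x = t_(t_u x) t_(s_x u).  With y = s_x u the left operation is
    y |> x = s_y (t_u x), so that
    t_y (T (y |> x)) = T (t_u x) <| y = t_y (T x) <| t_y (T y)
                     = t_y (T x <| T y),
    and t_y cancels.  The inverse of T is then an isomorphism from the right
    rack to the left one. *)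

Section StructureRacks.
Variables (X : finType) (r : solution X).
Local Notation s := (sigma r).
Local Notation t := (tau r).
Local Notation T := (Tmap r).

Lemma sigma_inj x : injective (s x).
Proof. exact: bij_inj (sol_sigma_bij r x). Qed.

Lemma tau_inj x : injective (t x).
Proof. exact: bij_inj (sol_tau_bij r x). Qed.

Lemma tau_Tmap y : t y (T y) = y.
Proof. exact: f_finv (@tau_inj y) y. Qed.

Lemma Tmap_eq y w : t y w = y -> T y = w.
Proof. by move=> tyw; apply: (@tau_inj y); rewrite tau_Tmap. Qed.

(** The counterpart of [left_op_sigma] under conjugation of r by the flip. *)
Lemma right_op_tau y a : right_op r y (t y a) = t (t y a) (s a y).
Proof. exact: (left_op_sigma (mirror r) y a). Qed.

(** The counterpart of [sigma_left_op] under conjugation of r by the flip. *)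
Lemma tau_right_op z x y :
  t z (right_op r x y) = right_op r (t z x) (t z y).
Proof. exact: (sigma_left_op (mirror r) z y x). Qed.

(** Both sides have the image y <| y under t_y. The formula recovers y from
    T y. *)
Lemma sigma_Tmap y : s (T y) y = right_op r (T y) (T y).
Proof.
apply: (@tau_inj y); rewrite tau_right_op tau_Tmap.
by have := right_op_tau y (T y); rewrite tau_Tmap => ->.
Qed.

Lemma Tmap_inj : injective T.
Proof.
move=> y y' eqT; apply: (@sigma_inj (T y)).
by rewrite sigma_Tmap eqT sigma_Tmap.
Qed.

(** Indeed t_(t_u x) (t_(s_x u) (T x)) = t_u (t_x (T x)) = t_u x. *)
Lemma Tmap_tau u x : T (t u x) = t (s x u) (T x).
Proof. by apply: Tmap_eq; rewrite -sol_tauE tau_Tmap. Qed.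

(** T is equivariant for s_x and the inverse of t_x only up to the right
    translation by x, which is trivial when r is involutive. *)
Lemma tau_Tmap_sigma x y : t x (T (s x y)) = right_op r (T y) x.
Proof.
apply: (@tau_inj y).
(* The braid identity makes t_(s_x y) act on T (s_x y), which it sends to
   s_x y; the value t_(t_y x) (s_x y) thus obtained is y <| t_y x. *)
by rewrite sol_tauE tau_Tmap tau_right_op tau_Tmap right_op_tau.
Qed.

Lemma Tmap_left_op x y : T (left_op r y x) = right_op r (T x) (T y).
Proof.
pose u := finv (s x) y; have Dy : s x u = y by exact: f_finv (@sigma_inj x) y.
apply: (@tau_inj y).
have -> : left_op r y x = s y (t u x) by [].
by rewrite tau_Tmap_sigma Tmap_tau Dy tau_right_op tau_Tmap.
Qed.

End StructureRacks.

Theorem proposition2p9 (X : finType) (r : solution X) :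
  rack_isomorphic (right_structure_rack r)
                  (right_of_left (left_structure_rack r)) /\
  bijective (Tmap r) /\
  (forall x y : X,
     Tmap r (left_structure_rack r y x)
     = right_structure_rack r (Tmap r x) (Tmap r y)).
Proof.
have Tinj := @Tmap_inj X r.
split; last by split; [exact: injF_bij | exact: Tmap_left_op].
have TK : cancel (finv (Tmap r)) (Tmap r) by exact: f_finv.
exists (finv (Tmap r)); first by exists (Tmap r); last exact: finv_f.
by move=> x y /=; apply: Tinj; rewrite Tmap_left_op !TK.
Qed.
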